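(* Let $n,k,r$ be positive integers with $1\le r\le n-k$, and let $G$ be a graph of order $n$ with vertex $k$-partiteness $v_k(G)=r$. Then $\mathcal{ABS}(G)\le \mathcal{ABS}(K_r\vee T(n-r,k))$. Equality holds if and only if $G\cong K_r\vee T(n-r,k)$.
   Context: All graphs are finite and simple. The $\mathcal{ABS}$ index of a graph $G$ is $\mathcal{ABS}(G)=\sum_{uv\in E(G)}\sqrt{1-\frac{2}{d(u)+d(v)}}$, where $d(v)$ is the degree of $v$ in $G$. The vertex $k$-partiteness $v_k(G)$ of a graph $G$ is the minimum number of vertices whose removal from $G$ results in a $k$-partite graph (a graph whose vertex set can be partitioned into $k$ independent sets, possibly empty). The Turán graph $T(m,k)$ is the complete $k$-partite graph on $m$ vertices with $k-s$ parts of size $t$ and $s$ parts of size $t+1$, where $m=kt+s$ and $0\le s<k$. The join $G_1\vee G_2$ is obtained from disjoint copies of $G_1$ and $G_2$ by joining each vertex of $G_1$ with every vertex of $G_2$. $K_r$ is the complete graph on $r$ vertices. *)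

(* Defs.v *)
From HB Require Import structures.
From mathcomp Require Import all_boot all_order all_algebra.
From mathcomp Require Import reals.

Set Implicit Arguments.
Unset Strict Implicit.
Unset Printing Implicit Defensive.

Import Order.TTheory GRing.Theory Num.Theory.

Record sgraph := SGraph {
  vertex :> finType;
  edge : rel vertex;
  edge_sym : symmetric edge;
  edge_irr : irreflexive edge }.

Definition isomorphic (G H : sgraph) : Prop :=
  exists2 f : G -> H, bijective f & forall u v, edge (f u) (f v) = edge u v.

Notation "G ≅ H" := (isomorphic G H) (at level 70, no associativity).

Definition degree (G : sgraph) (v : G) : nat := #|[set u | edge v u]|.

Definition edge_set (G : sgraph) : {set {set G}} :=
  [set [set p.1; p.2] | p : G * G & edge p.1 p.2].

(* The edge e = {u, v} has two distinct elements, so the inner sum is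
   d(u) + d(v). *)
Definition ABS (R : realType) (G : sgraph) : R :=
  (\sum_(e in edge_set G)
     Num.sqrt (1 - 2 / (\sum_(v in e) degree v)%:R))%R.

Section Induced.
Variables (G : sgraph) (A : {set G}).

Definition induced_edge : rel {v : G | v \in A} :=
  [rel u v | edge (val u) (val v)].

Lemma induced_sym : symmetric induced_edge.
Proof. by move=> u v; apply: edge_sym. Qed.

Lemma induced_irr : irreflexive induced_edge.
Proof. by move=> u; apply: edge_irr. Qed.

Definition induced : sgraph := SGraph induced_sym induced_irr.
End Induced.

Definition remove_vertices (G : sgraph) (S : {set G}) : sgraph :=
  induced (~: S).

Definition independent (G : sgraph) (A : {set G}) : bool :=
  [forall u in A, forall v in A, ~~ edge u v].

Definition partite (k : nat) (G : sgraph) : bool :=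
  [exists P : {ffun 'I_k -> {set G}},
    [&& \bigcup_i P i == [set: G],
        [forall i, forall j, (i != j) ==> [disjoint P i & P j]]
      & [forall i, independent (P i)]]].

Lemma partite_remove_all (k : nat) (G : sgraph) :
  partite k (remove_vertices [set: G]).
Proof.
have no_vertex (x : remove_vertices [set: G]) : False.
  by have := valP x; rewrite inE in_setT.
apply/existsP; exists [ffun=> set0]; apply/and3P; split.
- by apply/eqP/setP => x; case: (no_vertex x).
- apply/forallP => i; apply/forallP => j; apply/implyP => _.
  by rewrite !ffunE -setI_eq0 setI0.
- by apply/forallP => i; apply/forallP => x; case: (no_vertex x).
Qed.

(* v_k(G); the minimum is over a nonempty family by partite_remove_all. *)
Definition vertex_partiteness (k : nat) (G : sgraph) : nat :=
  #|[arg min_(S < [set: G] | partite k (remove_vertices S)) #|S|]|.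

Section Join.
Variables G H : sgraph.

Definition join_edge : rel (G + H)%type := fun x y =>
  match x, y with
  | inl u, inl v => edge u v
  | inr u, inr v => edge u v
  | _, _ => true
  end.

Lemma join_sym : symmetric join_edge.
Proof. by case=> u [] v //=; apply: edge_sym. Qed.

Lemma join_irr : irreflexive join_edge.
Proof. by case=> u; apply: edge_irr. Qed.

Definition join : sgraph := SGraph join_sym join_irr.
End Join.

Section Complete.
Variable r : nat.

Definition complete_edge : rel 'I_r := [rel u v | u != v].

Lemma complete_sym : symmetric complete_edge.
Proof. by move=> u v; rewrite /complete_edge /= eq_sym. Qed.

Lemma complete_irr : irreflexive complete_edge.
Proof. by move=> u; rewrite /complete_edge /= eqxx. Qed.

Definition complete : sgraph := SGraph complete_sym complete_irr.
End Complete.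

Section CompleteMultipartite.
Variables (k : nat) (p : 'I_k -> nat).

(* The vertices of part i are the pairs (i, j) with j < p i. *)
Definition multipartite_edge : rel {i : 'I_k & 'I_(p i)} :=
  [rel u v | tag u != tag v].

Lemma multipartite_sym : symmetric multipartite_edge.
Proof. by move=> u v; rewrite /multipartite_edge /= eq_sym. Qed.

Lemma multipartite_irr : irreflexive multipartite_edge.
Proof. by move=> u; rewrite /multipartite_edge /= eqxx. Qed.

Definition complete_multipartite : sgraph :=
  SGraph multipartite_sym multipartite_irr.
End CompleteMultipartite.

(* m = k t + s with t = m %/ k and s = m %% k; the first s parts are the
   ones of size t + 1. *)
Definition turan (m k : nat) : sgraph :=
  complete_multipartite
    (fun i : 'I_k => if i < m %% k then (m %/ k).+1 else m %/ k).

(* Main.v *)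
(** Delete a set of r vertices leaving a k-partite graph: G becomes a spanning
    subgraph of the complete multipartite graph of a coloring of its vertices by
    [r] singleton classes and [k] further classes.  The weight
    [sqrt (1 - 2 / d)] is increasing and concave in [d], so adding edges does not
    decrease ABS, and moving a vertex from a class of size a to one of size
    b < a - 1 strictly increases the ABS index of a complete multipartite graph:
    the product of the two sizes grows, while their sum is unchanged, and
    x |-> x * weight (N - x) is concave, which handles the edges towards the other
    classes.  A coloring of maximal ABS is therefore balanced, and its graph is
    the join of K_r with a Turan graph.  An edge weighs 0 only if its two degrees
    sum to 2, so the equality case needs an extra argument only when G has two
    vertices; there G has its unique possible edge because v_k(G) > 0. *)

Require Import Defs.
From mathcomp Require Import all_boot all_order all_algebra.
From mathcomp Require Import reals.
From mathcomp Require Import zify ring lra.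

Set Implicit Arguments.
Unset Strict Implicit.
Unset Printing Implicit Defensive.

Import Order.TTheory GRing.Theory Num.Theory.

(** * The weight of an edge as a function of its degree sum *)

Section Weight.
Variable R : realType.
Local Open Scope ring_scope.

Definition weight (d : nat) : R := Num.sqrt (1 - 2 / d%:R).

Lemma weight_ge0 d : 0 <= weight d.
Proof. exact: sqrtr_ge0. Qed.

Lemma weight_gt0 d : (2 < d)%N -> 0 < weight d.
Proof.
move=> d2; rewrite sqrtr_gt0 subr_gt0 ltr_pdivrMr ?mul1r ?ltr_nat //.
by rewrite ltr0n; lia.
Qed.

(** Positivity of [d] matters: division by zero yields 0, so [weight 0] is 1, whereas [weight 1] and
    [weight 2] are 0. *)
Lemma weight_homo d e : (0 < d <= e)%N -> weight d <= weight e.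
Proof.
move=> /andP[d0 de]; rewrite ler_wsqrtr // lerD2l lerN2 ler_wpM2l //.
by rewrite lef_pV2 ?posrE ?ltr0n ?ler_nat //; lia.
Qed.

(** The radicand 1 - 2/d is itself concave, and for the radicands u, v, w of [d], [d.+2], [d.+1] one
    gets (sqrt u + sqrt v)^2 <= 2(u + v) <= 4w. The bound on [d] keeps the radicands nonnegative. *)
Lemma weight_concave d :
  (1 < d)%N -> weight d + weight d.+2 <= 2 * weight d.+1.
Proof.
move=> d1; have d2 : 2 <= d%:R :> R by rewrite ler_nat.
have E1 : d.+1%:R = d%:R + 1 :> R by rewrite -natr1.
have E2 : d.+2%:R = d%:R + 2 :> R by rewrite -addn2 natrD.
rewrite /weight E1 E2; move: (d%:R : R) d2 => x x2.
set u := 1 - 2 / x; set v := 1 - 2 / (x + 2); set w := 1 - 2 / (x + 1).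
have u0 : 0 <= u by rewrite subr_ge0 ler_pdivrMr; lra.
have v0 : 0 <= v by rewrite subr_ge0 ler_pdivrMr; lra.
have w0 : 0 <= w by rewrite subr_ge0 ler_pdivrMr; lra.
have uvw : u + v <= 2 * w.
  rewrite -subr_ge0.
  have -> : 2 * w - (u + v) = 4 / (x * (x + 1) * (x + 2)).
    by rewrite /u /v /w; field; apply/and3P; split; apply/eqP; lra.
  by rewrite divr_ge0 // !mulr_ge0; lra.
have := sqr_sqrtr u0; have := sqr_sqrtr v0; have := sqr_sqrtr w0.
have := sqrtr_ge0 u; have := sqrtr_ge0 v; have := sqrtr_ge0 w.
move: (Num.sqrt u) (Num.sqrt v) (Num.sqrt w) => p q s s0 q0 p0 sw qv pu.
rewrite -ler_sqr ?nnegrE; [|lra|lra].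
have := sqr_ge0 (p - q); rewrite !expr2 in sw qv pu *; nra.
Qed.

Lemma weight_incr_anti d e :
  (1 < d <= e)%N -> weight e.+1 - weight e <= weight d.+1 - weight d.
Proof.
move=> /andP[d1]; elim: e => [|e IH]; first by lia.
rewrite leq_eqVlt ltnS => /orP[/eqP-> //|de].
have := IH de.
have := weight_concave (leq_trans d1 de); lra.
Qed.

(** A discrete form of the concavity of x |-> x weight(N - x): bringing the arguments [a] and [b]
    one step closer does not decrease the sum. *)
Lemma weight_smoothing N a b : (b.+1 < a)%N -> (a.+1 < N)%N ->
  a%:R * weight (N - a) + b%:R * weight (N - b)
  <= a.-1%:R * weight (N - a.-1) + b.+1%:R * weight (N - b.+1).
Proof.
case: a => [|a] //= ba aN.
have -> : (N - a = (N - a.+1).+1)%N by lia.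
have -> : (N - b = (N - b.+1).+1)%N by lia.
have D : (1 < N - a.+1 <= N - b.+1)%N by lia.
have := weight_incr_anti D.
have : weight (N - a.+1) <= weight (N - b.+1) by apply: weight_homo; lia.
have : weight (N - b.+1) <= weight (N - b.+1).+1 by apply: weight_homo; lia.
have b0 : 0 <= b%:R :> R by [].
have ba' : b%:R <= a%:R :> R by rewrite ler_nat; lia.
(* With [a] now the old [a.-1], the gain is a D - b D' + (weight(N-b-1) - weight(N-a-1)), where D >=
   D' >= 0 are the increments of the weight at N-a-1 and N-b-1, and a >= b. *)
rewrite -!natr1.
move: (weight _) (weight _) (weight _) (weight _) => y y' x x'.
nra.
Qed.

End Weight.

(** * ABS as a sum over ordered pairs; invariance and monotonicity *)

Section DegreeSum.
Variable R : realType.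
Local Open Scope ring_scope.

Lemma ABS_double (G : sgraph) :
  2 * ABS R G
  = \sum_(u : G) \sum_(v | edge u v) weight R (degree u + degree v).
Proof.
rewrite pair_big_dep /=.
rewrite (partition_big (fun p : G * G => [set p.1; p.2])
  (fun e => e \in edge_set G)) /=; last first.
  by move=> p ep; apply/imsetP; exists p; rewrite ?inE.
rewrite mulr_sumr; apply: eq_bigr => A /imsetP[[u v]]; rewrite inE /= => uv ->{A}.
have nuv : u != v by apply: contraTneq uv => ->; rewrite edge_irr.
(* The ordered pairs giving the edge {u, v} are exactly (u, v) and (v, u), whence the factor 2. *)
rewrite (eq_bigl (mem [set (u, v); (v, u)])); last first.
  move=> [x y] /=; rewrite !inE !xpair_eqE.
  apply/andP/orP => [[xy /eqP E]|]; last first.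
    by case=> /andP[/eqP-> /eqP->]; rewrite ?[edge v u]edge_sym ?[[set v; u]]setUC.
  have nxy : x != y by apply: contraTneq xy => ->; rewrite edge_irr.
  have := set21 x y; have := set22 x y; rewrite E !inE.
  by case/orP=> /eqP Ey /orP[]/eqP Ex; subst; rewrite !eqxx ?orbT in nxy *; auto.
rewrite big_setU1 ?big_set1 /= ?inE ?xpair_eqE ?negb_and ?nuv //.
rewrite big_setU1 ?big_set1 ?inE ?xpair_eqE ?negb_and ?nuv //=.
by rewrite [(degree v + _)%N]addnC mulr_natl mulr2n.
Qed.

Lemma isomorphic_degree (G H : sgraph) (f : G -> H) v :
  bijective f -> (forall u v, edge (f u) (f v) = edge u v) ->
  degree (f v) = degree v.
Proof.
move=> bf ef; rewrite /degree -(card_imset _ (bij_inj bf)).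
apply: eq_card => y; rewrite inE; case: bf => g gK fK; rewrite -[y]fK ef.
by rewrite mem_imset ?inE //; exact: can_inj gK.
Qed.

Lemma ABS_isomorphic (G H : sgraph) : G ≅ H -> ABS R G = ABS R H.
Proof.
case=> f bf ef; have two0 : 2 != 0 :> R by rewrite pnatr_eq0.
apply: (mulfI two0); rewrite !ABS_double.
rewrite [RHS](reindex f) /=; last exact: onW_bij.
apply: eq_bigr => u _; rewrite [RHS](reindex f) /=; last exact: onW_bij.
apply: eq_big => v; first by rewrite ef.
by rewrite !(isomorphic_degree _ bf ef).
Qed.


Section Subgraph.
Variables (G : sgraph) (e : rel G) (es : symmetric e) (ei : irreflexive e).
Let H := SGraph es ei.
Hypothesis sub : subrel (@edge G) e.

(** Extended by 0 to non-edges, the sums of both graphs range over the same pairs and compare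
    termwise. *)
Let F u v := if edge u v then weight R (@degree G u + @degree G v) else 0.
Let F' u v := if e u v then weight R (@degree H u + @degree H v) else 0.

Let FF' u v : F u v <= F' u v.
Proof.
rewrite /F /F'; case: ifP => uv; last by case: ifP => // _; apply: weight_ge0.
have deg x : (@degree G x <= @degree H x)%N.
  by apply: subset_leq_card; apply/subsetP => y; rewrite !inE; apply: sub.
(* The edge itself makes the degree of [u] positive, as monotonicity of the weight requires. *)
rewrite (sub uv); apply: weight_homo; rewrite leq_add // andbT addn_gt0.
by apply/orP; left; apply/card_gt0P; exists v; rewrite inE.
Qed.

Let ABS_F : 2 * ABS R G = \sum_u \sum_v F u v.
Proof. by rewrite ABS_double; apply: eq_bigr => u _; rewrite big_mkcond. Qed.

Let ABS_F' : 2 * ABS R H = \sum_u \sum_v F' u v.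
Proof. by rewrite ABS_double; apply: eq_bigr => u _; rewrite big_mkcond. Qed.

Lemma ABS_subgraph : ABS R G <= ABS R H.
Proof.
rewrite -(ler_pM2l (ltr0Sn R 1)) ABS_F ABS_F'.
by apply: ler_sum => u _; apply: ler_sum => v _.
Qed.

(** A missing edge would replace a positive term by 0 while no other term exceeds its counterpart,
    so the sums would differ. *)
Lemma ABS_subgraph_eq u v :
  ABS R G = ABS R H -> e u v -> (2 < @degree H u + @degree H v)%N -> edge u v.
Proof.
move=> /(congr1 ( *%R 2)); rewrite ABS_F ABS_F' !pair_big /= => E euv d3.
apply/negPn/negP => nuv; suff: F u v < F' u v.
  rewrite ltNge -(lerD2r (\sum_(p | p != (u, v)) F p.1 p.2)) => /negP[].
  move: E; rewrite (bigD1 (u, v)) // [RHS](bigD1 (u, v)) //= => ->.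
  by rewrite lerD2l; apply: ler_sum => p _.
by rewrite /F /F' (negPf nuv) euv weight_gt0.
Qed.
End Subgraph.
End DegreeSum.

(** * Complete multipartite graphs given by colorings *)

Section Multipartite.
Variables (T : finType) (L : finType) (c : T -> L).

(** The classes are the fibres of [c], possibly empty. Keeping [T] as vertex type makes a change of
    part sizes a mere recoloring. *)
Definition multi_edge : rel T := [rel u v | c u != c v].

Lemma multi_sym : symmetric multi_edge.
Proof. by move=> u v; rewrite /multi_edge /= eq_sym. Qed.

Lemma multi_irr : irreflexive multi_edge.
Proof. by move=> u; rewrite /multi_edge /= eqxx. Qed.

Definition multi : sgraph := SGraph multi_sym multi_irr.

Definition class_size (l : L) : nat := #|[set x | c x == l]|.

Lemma multi_degree v : @degree multi v = #|T| - class_size (c v).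
Proof.
rewrite -(cardsC [set x | c x == c v]) addKn.
by apply: eq_card => u; rewrite !inE /= eq_sym.
Qed.

Lemma sum_class_size : \sum_l class_size l = #|T|.
Proof.
rewrite -sum1_card (partition_big c xpredT) //=; apply: eq_bigr => l _.
by rewrite sum1dep_card; apply: eq_card => x; rewrite !inE.
Qed.

Lemma class_size2 l l' : l != l' -> class_size l + class_size l' <= #|T|.
Proof.
move=> nll; rewrite -sum_class_size (bigD1 l) //= (bigD1 l') 1?eq_sym //=; lia.
Qed.

(** Degrees are constant on classes, so the sum over ordered pairs of vertices collapses to one over
    ordered pairs of colors. *)
Lemma ABS_multi (R : realType) : (2 * ABS R multi
  = \sum_l \sum_(l' | l' != l) (class_size l)%:R * ((class_size l')%:R
      * weight R (2 * #|T| - class_size l - class_size l')))%R.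
Proof.
rewrite ABS_double (partition_big c xpredT) //=; apply: eq_bigr => l _.
transitivity (\sum_(u | c u == l) \sum_(l' | l' != l) (class_size l')%:R
      * weight R (2 * #|T| - class_size l - class_size l'))%R; last first.
  rewrite sumr_const -mulr_sumr mulr_natl; congr (_ *+ _)%R.
  by apply: eq_card => u; rewrite !inE.
apply: eq_bigr => u /eqP cu.
rewrite (partition_big c (fun l' => l' != l)) /=; last first.
  by move=> v; rewrite /multi_edge /= cu eq_sym.
apply: eq_bigr => l' nl'.
rewrite mulr_natl -sumr_const; apply: eq_big => [v|v].
  rewrite !inE /multi_edge /= cu andbC.
  by case: eqP => [->|//]; rewrite eq_sym nl'.
case/andP=> _ /eqP cv; rewrite !multi_degree cu cv; congr weight.
have := class_size2 nl'; move: (class_size l) (class_size l') #|T|; lia.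
Qed.
End Multipartite.

(** * Moving a vertex from a large class to a small one *)

Section Move.
Variables (R : realType) (L : finType).
Local Open Scope ring_scope.

(** Separates the pair {a, b}, the pairs meeting {a, b} once, and the pairs avoiding it, which a
    move between [a] and [b] affects differently. *)
Lemma sum_offdiag (E : L -> L -> R) a b :
  (forall l l', E l l' = E l' l) -> a != b ->
  \sum_l \sum_(l' | l' != l) E l l' =
  2 * E a b + 2 * (\sum_(l | (l != a) && (l != b)) (E a l + E b l))
  + \sum_(l | (l != a) && (l != b))
      \sum_(l' | [&& l' != l, l' != a & l' != b]) E l l'.
Proof.
move=> Es nab; have nba : b != a by rewrite eq_sym.
have split_at (x y : L) F : x != y -> \sum_(l | l != x) F l
    = F y + \sum_(l | (l != x) && (l != y)) F l :> R.
  by move=> nxy; rewrite (bigD1 y) 1?eq_sym.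
rewrite (bigD1 a) //= !(split_at a b) // (split_at b a) //.
rewrite [X in E b a + X](eq_bigl (fun l => (l != a) && (l != b))); last first.
  by move=> l; rewrite andbC.
have -> : \sum_(l | (l != a) && (l != b)) \sum_(l' | l' != l) E l l'
  = \sum_(l | (l != a) && (l != b)) (E a l + E b l)
  + \sum_(l | (l != a) && (l != b))
      \sum_(l' | [&& l' != l, l' != a & l' != b]) E l l'.
  rewrite -big_split /=; apply: eq_bigr => l /andP[la lb].
  rewrite (split_at l a) // (bigD1 b) /=; last by rewrite nba eq_sym lb.
  by rewrite addrA !(Es l); congr (_ + _); apply: eq_bigl => l'; rewrite andbA.
by rewrite big_split /= (Es b a); ring.
Qed.

(* [energy f] is [2 * ABS] of the complete multipartite graph on [n] vertices
   with part sizes [f], see [ABS_multi]. *)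
Lemma energy_smoothing n (p q : L -> nat) a b : a != b ->
  ((p b).+1 < p a)%N -> (p a + p b < n)%N ->
  (forall l, l != a -> p a + p l <= n)%N ->
  q a = (p a).-1 -> q b = (p b).+1 ->
  (forall l, l != a -> l != b -> q l = p l) ->
  let energy f := \sum_l \sum_(l' | l' != l)
    (f l)%:R * ((f l')%:R * weight R (2 * n - f l - f l')) in
  energy p < energy q.
Proof.
move=> nab pba pn pln qa qb ql /=.
have Es (f : L -> nat) l l' :
    (f l)%:R * ((f l')%:R * weight R (2 * n - f l - f l'))
    = (f l')%:R * ((f l)%:R * weight R (2 * n - f l' - f l)).
  by rewrite mulrCA subnAC.
rewrite !(sum_offdiag (Es _) nab); apply: ltr_leD; last first.
  rewrite le_eqVlt; apply/orP; left; apply/eqP.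
  apply: eq_bigr => l /andP[la lb]; apply: eq_bigr => l' /and3P[_ la' lb'].
  by rewrite !ql.
apply: ltr_leD.
  (* The strict gain: the product of the two sizes grows, their sum is unchanged, and their common
     weight is positive since [p a + p b < n]. *)
  rewrite ltr_pM2l ?ltr0n // !mulrA -!natrM qa qb.
  have -> : (2 * n - (p a).-1 - (p b).+1 = 2 * n - p a - p b)%N by lia.
  by rewrite ltr_pM2r ?ltr_nat ?weight_gt0 //; nia.
(* Towards a third class [l], factoring out [p l] leaves [weight_smoothing] with N = 2n - p l. *)
rewrite ler_pM2l ?ltr0n //; apply: ler_sum => l /andP[la lb].
rewrite !(ql l) // qa qb ![_%:R * ((p l)%:R * _)]mulrCA -!mulrDr.
rewrite ler_wpM2l // ![(2 * n - _ - p l)%N]subnAC.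
by apply: weight_smoothing => //; have := pln _ la; lia.
Qed.

Lemma ABS_multi_move (T : finType) (c : T -> L) v b : c v != b ->
  ((class_size c b).+1 < class_size c (c v))%N ->
  (class_size c (c v) + class_size c b < #|T|)%N ->
  ABS R (multi c) < ABS R (multi [ffun x => if x == v then b else c x]).
Proof.
move=> nab sba sab; rewrite -(ltr_pM2l (ltr0Sn R 1)) !ABS_multi.
apply: (@energy_smoothing _ _ _ (c v) b) => //.
- by move=> l la; apply: class_size2; rewrite eq_sym.
- rewrite /class_size (cardsD1 v [set x | c x == c v]) inE eqxx /=.
  apply: eq_card => x; rewrite !inE ffunE; case: (eqVneq x v) => //= _.
  by rewrite eq_sym (negPf nab).
- rewrite /class_size (cardsD1 v) !inE ffunE !eqxx add1n; congr _.+1.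
  apply: eq_card => x; rewrite !inE ffunE; case: (eqVneq x v) => //= ->.
  by rewrite (negPf nab).
- move=> l la lb; apply: eq_card => x; rewrite !inE ffunE.
  case: (eqVneq x v) => //= ->.
  by rewrite ![_ == l]eq_sym (negPf la) (negPf lb).
Qed.

End Move.

(** * Color-preserving maps from fibre sizes *)

Lemma card_fiber_inj (T T' : finType) (L : eqType) (c : T -> L) (c' : T' -> L) :
  (forall l, #|[set x | c x == l]| <= #|[set x | c' x == l]|) ->
  exists2 f : T -> T', injective f & forall x, c' (f x) = c x.
Proof.
(* If [T'] is empty, so is [T]; otherwise [y0] is a default for [nth]. *)
move=> le; case: (pickP (@predT T')) => [y0 _ | T0]; last first.
  have noT (x : T) : False.
    have := le (c x); rewrite [X in _ <= X]eq_card0; last by move=> y; have := T0 y.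
    by rewrite leqn0 cards_eq0 => /eqP/setP/(_ x); rewrite !inE eqxx.
  by exists (fun x => False_rect _ (noT x)) => x; case: (noT x).
pose A l := enum [set x | c x == l]; pose A' l := enum [set x | c' x == l].
have xA x : x \in A (c x) by rewrite mem_enum inE.
have idx x : index x (A (c x)) < size (A' (c x)).
  by rewrite -cardE (leq_trans _ (le _)) // cardE index_mem.
have cf x : c' (nth y0 (A' (c x)) (index x (A (c x)))) = c x.
  by have := mem_nth y0 (idx x); rewrite mem_enum inE => /eqP.
(* Each [x] goes to the element of the same rank in the fibre of [c'] over [c x]. *)
exists (fun x => nth y0 (A' (c x)) (index x (A (c x)))) => // x y /= E.
have cxy : c x = c y by rewrite -cf E cf.
move: E (idx x) (idx y) (xA x) (xA y); rewrite cxy => /eqP E ix iy Ax Ay.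
by move: E; rewrite nth_uniq ?enum_uniq // => /eqP; apply: index_inj.
Qed.

Lemma card_fiber_bij (T T' : finType) (L : eqType) (c : T -> L) (c' : T' -> L) :
  (forall l, #|[set x | c x == l]| = #|[set x | c' x == l]|) ->
  exists2 f : T -> T', bijective f & forall x, c' (f x) = c x.
Proof.
move=> E; have [|f fI cf] := @card_fiber_inj _ _ _ c c'; first by move=> l; rewrite E.
have [|g gI _] := @card_fiber_inj _ _ _ c' c; first by move=> l; rewrite E.
by exists f => //; apply: inj_card_bij => //; apply: leq_card gI.
Qed.

(** * Balanced part sizes are those of the Turan graph *)

Section Balanced.
Variables (k m : nat).
Hypothesis k0 : 0 < k.

Definition turan_part (i : 'I_k) : nat :=
  if i < m %% k then (m %/ k).+1 else m %/ k.

(** With [p j] minimal, every part has size [p j] or [p j + 1]. If [A] indexes the larger ones, m =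
    k p(j) + |A| is the Euclidean division of [m] by [k], because [j] lies outside [A]. *)
Lemma balanced_turan (p : 'I_k -> nat) :
  (forall i j, p i <= (p j).+1) -> \sum_i p i = m ->
  exists2 s : 'I_k -> 'I_k, bijective s & forall i, turan_part (s i) = p i.
Proof.
move=> bal sum_p; pose i0 := Ordinal k0.
case: (arg_minnP p (isT : xpredT i0)) => j _ jmin.
pose A := [set i | p i == (p j).+1].
have pA i : p i = p j + (i \in A).
  by have := jmin i isT; have := bal i j; rewrite inE; case: eqP; lia.
have Ak : #|A| < k.
  rewrite -[X in _ < X]card_ord -cardsT proper_card // properT.
  by apply/eqP => /setP/(_ j); rewrite !inE; lia.
have mE : m = p j * k + #|A|.
  rewrite -sum_p (eq_bigr _ (fun i _ => pA i)) big_split /= sum_nat_const.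
  by rewrite card_ord mulnC -big_mkcond sum1_card.
have tE : m %/ k = p j by rewrite mE divnMDl // divn_small ?addn0.
have sE : m %% k = #|A| by rewrite mE modnMDl modn_small.
have cardT : #|[set i : 'I_k | i < #|A|]| = #|A|.
  rewrite -[LHS]sum1dep_card -(big_ord_widen _ (fun=> 1) (ltnW Ak)).
  by rewrite sum1_card card_ord.
(* Viewed as two-colorings of the indices, [A] and the first |A| indices have equal fibres; the
   resulting bijection is [s]. *)
case: (@card_fiber_bij _ _ _ (fun i => i \in A) (fun i : 'I_k => i < #|A|)) => [|s bs cs].
  case.
    transitivity #|A|; first by apply: eq_card => i; rewrite inE eqb_id.
    by rewrite -[LHS]cardT; apply: eq_card => i; rewrite !inE eqb_id.
  transitivity (k - #|A|).
    apply/esym/(canLR (addKn _)); rewrite -[LHS](card_ord k) -(cardsC A).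
    by congr (_ + _); apply: eq_card => i; rewrite !inE eqbF_neg.
  apply/(canLR (addKn _)); rewrite -[LHS](card_ord k).
  rewrite -(cardsC [set i : 'I_k | i < #|A|]) cardT.
  by congr (_ + _); apply: eq_card => i; rewrite !inE eqbF_neg.
exists s => // i; rewrite /turan_part sE tE cs [p i]pA /=.
by case: (i \in A); lia.
Qed.
End Balanced.

(** * The extremal graph as a complete multipartite graph *)

Section Target.
Variables r k m : nat.

Let H := join (complete r) (turan m k).

Definition join_turan_class (x : H) : 'I_r + 'I_k :=
  match x with inl i => inl i | inr y => inr (tag y) end.

Lemma join_turan_edge (x y : H) :
  edge x y = (join_turan_class x != join_turan_class y).
Proof. by case: x y => [x|x] [y|y]. Qed.

Lemma join_turan_class_size_inl i : class_size join_turan_class (inl i) = 1.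
Proof.
rewrite /class_size -[RHS](cards1 (inl i : H)).
by apply: eq_card => -[x|x]; rewrite !inE.
Qed.

Lemma join_turan_class_size_inr i :
  class_size join_turan_class (inr i) = turan_part m i.
Proof.
rewrite /class_size -[RHS]card_ord -cardsT.
pose f (j : 'I_(turan_part m i)) : H := inr (existT _ i j).
have fI : injective f by move=> x y [] /eqP; rewrite eq_Tagged => /eqP.
rewrite -(card_imset _ fI); apply: eq_card => x; rewrite !inE.
apply/eqP/imsetP => [|[j _ ->] //].
by case: x => // -[i' j] [/= Ei]; subst i'; exists j.
Qed.

(** After relabelling colors by [s], the fibre sizes agree with those of [join_turan_class], and a
    color-preserving bijection is an isomorphism, since adjacency means distinct colors. *)
Lemma multi_join_turan (T : finType) (c : T -> 'I_r + 'I_k)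
    (s : 'I_k -> 'I_k) : bijective s ->
  (forall i, class_size c (inl i) = 1) ->
  (forall i, class_size c (inr i) = turan_part m (s i)) ->
  multi c ≅ H.
Proof.
move=> [s' sK s'K] cl cr.
pose t (l : 'I_r + 'I_k) : 'I_r + 'I_k :=
  match l with inl i => inl i | inr i => inr (s i) end.
pose t' (l : 'I_r + 'I_k) : 'I_r + 'I_k :=
  match l with inl i => inl i | inr i => inr (s' i) end.
have tK : cancel t t' by case=> //= i; rewrite sK.
have t'K : cancel t' t by case=> //= i; rewrite s'K.
case: (@card_fiber_bij _ _ _ (t \o c) join_turan_class) => [l|f bf cf].
  transitivity (class_size c (t' l)).
    by apply: eq_card => x; rewrite !inE (can2_eq tK t'K).
  rewrite -[RHS]/(class_size join_turan_class l).
  case: l => i /=; first by rewrite cl join_turan_class_size_inl.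
  by rewrite cr join_turan_class_size_inr s'K.
exists f => // u v; rewrite join_turan_edge !cf /=.
by rewrite (can_eq tK).
Qed.
End Target.

(** * Maximal colorings with [r] singleton classes *)

Section Extremal.
Variables (R : realType) (T : finType) (r k : nat).
Hypotheses (r0 : 0 < r) (k0 : 0 < k).

Let H := join (complete r) (turan (#|T| - r) k).

Let singletons (c : {ffun T -> 'I_r + 'I_k}) :=
  [forall i, class_size c (inl i) == 1].

Lemma sum_part_sizes (c : {ffun T -> 'I_r + 'I_k}) : singletons c ->
  r + \sum_i class_size c (inr i) = #|T|.
Proof.
move=> /forallP cs; rewrite -(sum_class_size c) big_sumType /=; congr (_ + _).
under eq_bigr => i _ do rewrite (eqP (cs i)).
by rewrite sum1_card card_ord.
Qed.

Lemma maximal_multi (c : {ffun T -> 'I_r + 'I_k}) : singletons c ->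
  (forall c', singletons c' -> ABS R (multi c') <= ABS R (multi c))%R ->
  multi c ≅ H.
Proof.
move=> cs cmax; have := forallP cs => cl.
case: (@balanced_turan k (#|T| - r) k0 (fun i => class_size c (inr i))).
- move=> i j /=; rewrite leqNgt; apply/negP => lt.
  have [v] : exists v, v \in [set x | c x == inr i].
    by apply/card_gt0P; apply: leq_trans lt.
  rewrite inE => /eqP cv.
  have nij : inr i != inr j :> 'I_r + 'I_k.
    by apply: contraTneq lt => ->; lia.
  (* As [r] is positive, some singleton class lies outside the two classes considered. *)
  have nt : class_size c (inr i) + class_size c (inr j) < #|T|.
    rewrite -(sum_class_size c) (bigD1 (inr i)) //=.
    rewrite (bigD1 (inr j)) 1?eq_sym //=.
    by rewrite (bigD1 (inl (Ordinal r0))) //= (eqP (cl _)); lia.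
  rewrite -cv in nij lt nt.
  have := ABS_multi_move R nij lt nt; rewrite ltNge cmax //.
  (* The vertex [v] passes from [inr i] to [inr j], so the singleton classes are untouched. *)
  apply/forallP => l; rewrite -(eqP (cl l)); apply/eqP/eq_card => x.
  by rewrite !inE ffunE; case: (eqVneq x v) => // ->; rewrite cv.
- by rewrite -(sum_part_sizes cs) addKn.
- move=> s bs sE; apply: (multi_join_turan bs) => i; last by rewrite sE.
  exact/eqP.
Qed.

(** A maximizer [d] exists by finiteness, and its graph is isomorphic to [H]. A coloring attaining
    the value of [H] is then itself maximal. *)
Lemma ABS_multi_le (c : {ffun T -> 'I_r + 'I_k}) : singletons c ->
  (ABS R (multi c) <= ABS R H)%R /\ (ABS R (multi c) = ABS R H -> multi c ≅ H).
Proof.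
move=> cs; case: (Order.TotalTheory.arg_maxP (fun c : {ffun T -> _} => ABS R (multi c)) cs).
move=> d ds dmax; have dH := ABS_isomorphic R (maximal_multi ds dmax).
by rewrite -dH; split=> [|E]; [apply: dmax | apply: maximal_multi; rewrite ?E].
Qed.
End Extremal.

(** * From vertex partiteness to colorings *)

Lemma vertex_partiteness_witness k (G : sgraph) :
  exists2 S : {set G}, #|S| = vertex_partiteness k G
                     & partite k (remove_vertices S).
Proof.
rewrite /vertex_partiteness; case: arg_minnP; first exact: partite_remove_all.
by move=> S pS _; exists S.
Qed.

Lemma vertex_partiteness_gt0 k (G : sgraph) : 0 < k ->
  0 < vertex_partiteness k G -> exists u v : G, edge u v.
Proof.
move=> k0 v0; have [/existsP[u /existsP[v uv]]|/existsPn noedge] :=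
  boolP [exists u : G, exists v, edge u v]; first by exists u, v.
move: v0; rewrite /vertex_partiteness; case: arg_minnP; first exact: partite_remove_all.
move=> S _ /(_ set0); rewrite cards0 => minS; rewrite lt0n; case/negP.
(* Without edges nothing need be removed: one part takes all vertices, the others are empty. *)
rewrite -leqn0 minS //; apply/existsP; exists [ffun i => if i == Ordinal k0 then setT else set0].
apply/and3P; split.
- apply/eqP/setP => x; rewrite in_setT; apply/bigcupP.
  by exists (Ordinal k0) => //; rewrite ffunE eqxx.
- apply/forallP => i; apply/forallP => j; apply/implyP => nij.
  rewrite !ffunE -setI_eq0; have [Ei|_] := eqVneq i (Ordinal k0).
    by rewrite -Ei [j == i]eq_sym (negPf nij) setI0.
  by rewrite set0I.
- apply/forallP => i; apply/forallP => u; apply/implyP => _.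
  apply/forallP => v; apply/implyP => _; have /existsPn := noedge (val u).
  exact.
Qed.

Lemma partite_coloring k (G : sgraph) : partite k G ->
  exists f : G -> 'I_k, forall u v, edge u v -> f u != f v.
Proof.
case/existsP => P /and3P[/eqP cover _ /forallP indep].
have /fin_all_exists[f fP] (x : G) : exists i, x \in P i.
  have : x \in \bigcup_i P i by rewrite cover inE.
  by case/bigcupP => i _ xi; exists i.
exists f => u v; apply: contraTneq => fuv.
have := indep (f u); move/forallP/(_ u)/implyP/(_ (fP u)).
by move/forallP/(_ v)/implyP; apply; rewrite fuv.
Qed.

Lemma partite_multi k (G : sgraph) (S : {set G}) : 0 < #|S| ->
  partite k (remove_vertices S) ->
  exists2 c : {ffun G -> 'I_#|S| + 'I_k},
    [forall i, class_size c (inl i) == 1] & subrel (@edge G) (multi_edge c).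
Proof.
case/card_gt0P => x0 x0S /partite_coloring[f fP].
(* Vertices of [S] get their rank in [S] as a private color; the others keep the color of their
   part. [x0] serves as default for the rank. *)
pose c : {ffun G -> 'I_#|S| + 'I_k} :=
  [ffun x => if insub x is Some y then inr (f y)
             else inl (enum_rank_in x0S x)].
have cS x : x \in S -> c x = inl (enum_rank_in x0S x).
  by move=> xS; rewrite ffunE insubN // inE xS.
exists c.
  apply/forallP => i; apply/eqP; rewrite -[RHS](cards1 (enum_val i)).
  apply: eq_card => x; rewrite !inE; case: (boolP (x \in S)) => xS.
    rewrite cS //; apply/eqP/eqP => [[<-]|->].
      by rewrite enum_rankK_in.
    by rewrite enum_valK_in.
  rewrite ffunE insubT ?inE // => xS'; rewrite [RHS](negbTE _) //.
  by apply: contraNneq xS => ->; apply: enum_valP.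
move=> u v uv; rewrite /multi_edge /=.
case: (boolP (u \in S)) => uS; case: (boolP (v \in S)) => vS.
- rewrite !cS //; apply/eqP => -[] /(congr1 enum_val).
  by rewrite !enum_rankK_in // => E; rewrite E edge_irr in uv.
- by rewrite cS // ffunE insubT ?inE.
- by rewrite [c v]cS // ffunE insubT ?inE.
- rewrite !ffunE !insubT ?inE // => vS' uS'.
  by apply: contraNneq (fP (Sub u uS') (Sub v vS') uv) => -[->].
Qed.

(** * The bound and its equality case *)

Theorem theorem3p3 (R : realType) (n k r : nat) (G : sgraph) :
  0 < n -> 0 < k -> 1 <= r <= n - k ->
  #|G| = n ->
  vertex_partiteness k G = r ->
  (ABS R G <= ABS R (join (complete r) (turan (n - r) k)))%R /\
  (ABS R G = ABS R (join (complete r) (turan (n - r) k)) <->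
   G ≅ join (complete r) (turan (n - r) k)).
Proof.
move=> _ k0 /andP[r0 _] cardG vG.
have [a [b ab]] : exists u v : G, edge u v.
  by apply: (vertex_partiteness_gt0 k0); rewrite vG.
have [S cardS pS] := vertex_partiteness_witness k G.
rewrite vG in cardS; rewrite -cardS in r0 *; rewrite -{}cardG.
have [c cs sub] := partite_multi r0 pS.
have [le eq_iso] := ABS_multi_le R r0 k0 cs.
have leG : (ABS R G <= ABS R (multi c))%R := ABS_subgraph R _ _ sub.
split; first exact: le_trans le.
split=> [E|]; last exact: ABS_isomorphic.
(* The value for [multi c] lies between those for [G] and for the join, which are equal. *)
have Ec : ABS R G = ABS R (multi c).
  by apply/eqP; rewrite eq_le leG E.
have [f bf ef] : multi c ≅ join (complete #|S|) (turan (#|G| - #|S|) k).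
  by apply: eq_iso; rewrite -Ec.
exists f => // u v; rewrite ef; apply/idP/idP => [uv|]; last exact: sub.
have nuv : u != v by apply: contraTneq uv => ->; rewrite edge_irr.
have n2 : #|[set u; v]| = 2 by rewrite cards2 nuv.
case: (ltnP 2 #|G|) => n3.
  (* Two distinct classes have at most |G| vertices together, so the degree sum in [multi c] is at
     least |G| > 2. *)
  apply: (ABS_subgraph_eq sub Ec uv); rewrite !multi_degree.
  by have := class_size2 c uv; move: (class_size _ _) (class_size _ _); lia.
(* Here [G] has only the vertices [u] and [v], so its edge [ab] must be [uv]. *)
have all_uv (x : G) : x \in [set u; v].
  suff -> : [set u; v] = setT by rewrite inE.
  by apply/eqP; rewrite eqEcard subsetT cardsT n2.
have := all_uv a; have := all_uv b; rewrite !inE.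
case/orP => /eqP Eb /orP[] /eqP Ea; move: ab; rewrite Ea Eb ?edge_irr //.
by rewrite edge_sym.
Qed.
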